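(* Let $n\ge 0$ be an integer and let $J\subset\mathbb{R}$ be an interval. For every integer $\lambda\ge 1$ and every triple $(u,v,w)$ of complex-valued functions of class $\mathcal{C}^n$ on $J$ such that $u$ does not vanish on $J$, one has on $J$ $$\sum_{p=0}^{n}\binom{n}{p}\frac{1}{p+\lambda}D^{p}\left(u^{p+\lambda}w\right)D^{n-p}\left(u^{-p-\lambda}v\right)=\sum_{p=0}^{n}\binom{n}{p}\frac{1}{p+\lambda}D^{p}(w)\,D^{n-p}(v).$$
   Context: $D$ denotes differentiation of complex-valued functions on a real interval and $D^k$ its $k$-th iterate ($D^0$ = identity). All intervals contain at least two distinct points. *)

(* Defs.v *)
From HB Require Import structures.
From mathcomp Require Import all_boot all_order all_algebra.
From mathcomp Require Import complex.
From mathcomp Require Import all_classical all_reals all_analysis.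
Set Implicit Arguments.
Unset Strict Implicit.
Unset Printing Implicit Defensive.
Import Order.TTheory GRing.Theory Num.Theory numFieldNormedType.Exports.
Local Open Scope classical_set_scope.
Local Open Scope complex_scope.
Local Open Scope ring_scope.

(* The cast makes the topology that every numFieldType carries available on
   the complex numbers. *)
Notation Cplx R := (Num.NumField.sort (complex R : numFieldType)).

Definition nontrivial_interval (R : realType) (J : set R) : Prop :=
  is_interval J /\ exists a b : R, [/\ J a, J b & a < b].

(* A function on J is the restriction to J of a total function. The difference
   quotient at x is taken along points of J different from x, so that the
   derivative at an endpoint of J belonging to J is one-sided; for x in J,
   none of these notions depends on values outside J. *)
Definition diff_quotient (R : realType) (f : R -> Cplx R) (x y : R) : Cplx R :=
  (f y - f x) / (y - x)%:C.

Definition derivable_in (R : realType) (J : set R) (f : R -> Cplx R) (x : R)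
    : Prop :=
  cvg (diff_quotient f x y @[y --> within J x^']).

Definition deriv_in (R : realType) (J : set R) (f : R -> Cplx R)
    : R -> Cplx R :=
  fun x => lim (diff_quotient f x y @[y --> within J x^']).

Definition derivn_in (R : realType) (J : set R) (k : nat) (f : R -> Cplx R)
    : R -> Cplx R :=
  iter k (deriv_in J) f.

Definition class_C (R : realType) (n : nat) (J : set R) (f : R -> Cplx R)
    : Prop :=
  (forall k : nat, (k < n)%N -> forall x : R, J x ->
     derivable_in J (derivn_in J k f) x) /\
  {within J, continuous (derivn_in J n f)}.

(* Main.v *)
Require Import Defs.
From HB Require Import structures.
From mathcomp Require Import all_boot all_order all_algebra.
From mathcomp Require Import complex.
From mathcomp Require Import all_classical all_reals all_analysis.
From mathcomp Require Import ring lra.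
Import Order.TTheory GRing.Theory Num.Theory numFieldNormedType.Exports.
Local Open Scope classical_set_scope.
Local Open Scope ring_scope.

(** Fix a point [x] of [J]. Both sides involve [u], [v], [w] only through their
derivatives of order at most [n] at [x], so the identity is one between
coefficients of Taylor polynomials at [x]. Negative powers of [u] disappear
after the substitution [v = u ^ (n + lam) z] with [z = u ^ (- n - lam) v],
since then [u ^ (- p - lam) v = u ^ (n - p) z]. Let [U], [W], [Z] be Taylor
polynomials of [u], [w], [z], and write [[t^k]] for the coefficient of [t^k].
Dividing by [n!] turns the statement into
  [sum_p 1/(p+lam) [t^p](U^(p+lam) W) [t^(n-p)](U^(n-p) Z)
     = sum_p 1/(p+lam) [t^p]W [t^(n-p)](U^(n+lam) Z)],
which is [rothe_bilinear]. Both sides are linear in [W], and for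
[W = t^a] this is the Rothe-Hagen type convolution identity [rothe]:
  [sum_(q<=m) 1/(q+mu) [t^q]U^(q+mu) [t^(m-q)](U^(m-q) Z)
     = 1/mu [t^m](U^(m+mu) Z)],  with [m = n - a], [mu = a + lam].
It is proved by induction on [m], for all [Z] at once, splitting
[Z = c + t Z']: the part [t Z'] is the case [m - 1] for [U Z'], and the
constant part is reduced to the case [m - 1] for [U'] by the relation
[[t^k]U^k = [t^(k-1)](U^(k-1) U')], the coefficient form of
[(U^k)' = k U^(k-1) U'].

The analytic part shows that Taylor polynomials, taken along [J], are
compatible with products, powers and inverses ([taylor_atM], [taylor_atX],
[taylor_atV]). The relation [taylor_at n f P] is defined by recursion on the
order, replacing [f] and [P] by their derivatives, so that each of these facts
only needs the corresponding rule for first derivatives and no Leibniz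
formula. *)

Set Implicit Arguments.
Unset Strict Implicit.

(** * A Rothe-Hagen convolution identity for powers of a polynomial *)

Section Rothe.
Variable K : numFieldType.
Implicit Types U W Z : {poly K}.

Lemma coef_exp_deriv U (N k : nat) :
  N.+1%:R * (U ^+ N * U^`())`_k = k.+1%:R * (U ^+ N.+1)`_k.+1.
Proof. by rewrite !mulr_natl -coef_deriv deriv_exp coefMn mulrC. Qed.

Lemma coef_exp_diag U (k : nat) :
  (U ^+ k.+1)`_k.+1 = (U ^+ k * U^`())`_k.
Proof.
have nz : k.+1%:R != 0 :> K by rewrite pnatr_eq0.
by apply: (mulfI nz); rewrite coef_exp_deriv.
Qed.

Lemma poly_const_shift Z : exists Z' : {poly K}, Z = (Z`_0)%:P + Z' * 'X.
Proof.
exists (drop_poly 1 Z).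
rewrite -{1}(poly_take_drop 1 Z) expr1; congr (_ + _).
by apply/polyP=> -[|i]; rewrite coef_take_poly coefC.
Qed.

(** With [Z = 1] this expands [U ^ mu] in powers of [t / U], with the
coefficients [mu / (q + mu) [t^q]U^(q+mu)] given by Lagrange inversion. The
arbitrary factor [Z] is what lets the induction on [m] go through. *)
Lemma rothe U (mu m : nat) Z : (0 < mu)%N ->
  \sum_(q < m.+1) (q + mu)%:R^-1 * (U ^+ (q + mu))`_q
      * (U ^+ (m - q) * Z)`_(m - q)
  = mu%:R^-1 * (U ^+ (m + mu) * Z)`_m.
Proof.
move=> mu_gt0; elim: m Z => [|m IHm] Z.
  by rewrite big_ord1 !add0n subn0 expr0 mul1r !coef0M !mulrA.
have [Z' ->] := poly_const_shift Z; set c := _`_0.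
rewrite big_ord_recr /= subnn expr0 mul1r.
(* All terms but the last are those of order m for the polynomial
   c U' + U Z'. *)
have step (q : 'I_m.+1) :
  (U ^+ (m.+1 - q) * (c%:P + Z' * 'X))`_(m.+1 - q)
  = (U ^+ (m - q) * (c *: U^`() + U * Z'))`_(m - q).
  rewrite subSn; last by rewrite -ltnS.
  rewrite !mulrDr !coefD coefMC -scalerAr coefZ coef_exp_diag mulrC.
  by rewrite !mulrA coefMX /= -exprSr.
under eq_bigr => q _ do rewrite step.
rewrite IHm coefD coefC coefMX /= addr0.
rewrite !mulrDr !coefD !mulrA coefMX coefMC /=.
rewrite -scalerAr coefZ -exprSr -addSn.
(* The terms in Z' agree; the terms in c are multiples of b, and their
   factors match because (m+1) / (mu (m+1+mu)) + 1 / (m+1+mu) = 1 / mu. *)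
have := coef_exp_deriv U (m + mu) m.
rewrite -addSn; set a := (_ * U^`())`_m; set b := (U ^+ _)`_m.+1 => e.
have nz : (m.+1 + mu)%:R != 0 :> K by rewrite pnatr_eq0.
have nzm : mu%:R != 0 :> K by rewrite pnatr_eq0 -lt0n.
have -> : a = (m.+1 + mu)%:R^-1 * (m.+1%:R * b) by rewrite -e mulKf.
rewrite natrD in nz *; field.
by rewrite nzm -nat1r in nz *.
Qed.

Lemma rothe_bilinear U W Z (n lam : nat) : (0 < lam)%N ->
  \sum_(p < n.+1) (p + lam)%:R^-1 * (U ^+ (p + lam) * W)`_p
      * (U ^+ (n - p) * Z)`_(n - p)
  = \sum_(p < n.+1) (p + lam)%:R^-1 * W`_p * (U ^+ (n + lam) * Z)`_(n - p).
Proof.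
move=> lam_gt0.
pose G a p := (p + lam)%:R^-1 * W`_a * (U ^+ (p + lam))`_(p - a)
      * (U ^+ (n - p) * Z)`_(n - p).
transitivity (\sum_(p < n.+1) \sum_(a < n.+1 | (a <= p)%N) G a p).
  apply: eq_bigr => p _.
  transitivity (\sum_(a < p.+1) G a p); last first.
    exact: (big_ord_widen _ (fun a => G a p)).
  rewrite coefMr mulr_sumr mulr_suml; apply: eq_bigr => a _.
  rewrite /G; ring.
rewrite (exchange_big_dep xpredT) //=; apply: eq_bigr => a _.
have a_le : (a <= n)%N by rewrite -ltnS.
(* For fixed a, the substitution p = q + a gives the sum of the lemma rothe
   with mu = a + lam and m = n - a. *)
rewrite -(big_geq_mkord _ _ xpredT (G a)) -{1}(add0n a) big_addn big_mkord.
rewrite subSn //.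
have := rothe U (n - a) Z (ltn_addl a lam_gt0).
rewrite addnA subnK // mulrAC => <-; rewrite mulr_suml.
apply: eq_bigr => q _.
by rewrite /G addnK addnA -subnDA (addnC a q); ring.
Qed.

End Rothe.

(** * First-order differentiation along an interval *)

Section Derivative.
Context (R : realType) (J : set R) (x : R).
Context (hJ : nontrivial_interval J) (Jx : J x).
Local Notation F := (within J x^').
Implicit Types f g : R -> Cplx R.

(** Points of [J] other than [x] accumulate at [x], because [J] contains the
whole segment from [x] to some other point. Limits along [F] are therefore
unique. *)
Lemma within_dnbhs_proper : ProperFilter F.
Proof.
case: hJ => itJ [a [b [Ja Jb ab]]].
apply: Build_ProperFilter_ex => P.
rewrite /within /= /dnbhs /within /= => /nbhs_ballP [e /= e0 he].
have [c [Jc cx]] : exists c, J c /\ c != x.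
  have [->|ax] := eqVneq x a; first by exists b; rewrite gt_eqF.
  by exists a; rewrite eq_sym.
have [xc|cx'] := ltrP x c.
  pose y := Num.min c (x + e / 2).
  have xy : x < y by rewrite /y lt_min; apply/andP; split; lra.
  have yc : y <= c by rewrite /y ge_min lexx.
  have ye : y <= x + e / 2 by rewrite /y ge_min lexx orbT.
  exists y; apply: he.
  - rewrite /ball /= distrC gtr0_norm; lra.
  - by rewrite gt_eqF.
  - apply: (itJ x c) => //; apply/andP; split; lra.
have {}cx : c < x by rewrite lt_neqAle cx.
pose y := Num.max c (x - e / 2).
have xy : y < x by rewrite /y gt_max; apply/andP; split; lra.
have yc : c <= y by rewrite /y le_max lexx.
have ye : x - e / 2 <= y by rewrite /y le_max lexx orbT.
exists y; apply: he.
- rewrite /ball /= gtr0_norm; lra.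
- by rewrite lt_eqF.
- apply: (itJ c x) => //; apply/andP; split; lra.
Qed.

Lemma near_within_dnbhs (P : R -> Prop) :
  (forall y, J y -> y != x -> P y) -> \forall y \near F, P y.
Proof.
move=> H; rewrite /within /= /dnbhs /within /=.
by apply/nbhs_ballP; exists 1 => //= y _ yx Jy; exact: H.
Qed.

Lemma cvg_increment0 :
  (fun y => (y - x)%:C%C : Cplx R) y @[y --> F] --> (0 : Cplx R).
Proof.
apply/cvgr0Pnorm_lt => -[e1 e2] e0.
have [e10 e20] : 0 < e1 /\ e2 = 0.
  by move: e0; rewrite ltcE /= => /andP [/eqP -> ->].
rewrite /within /= /dnbhs /within /=.
apply/nbhs_ballP; exists e1 => //= y yx _ _.
rewrite normc_def /= expr0n addr0 sqrtr_sqr e20 ltcR.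
by rewrite distrC; exact: yx.
Qed.

Lemma derivable_in_cvg f : derivable_in J f x -> f y @[y --> F] --> f x.
Proof.
move=> df; have FF := within_dnbhs_proper.
have : (diff_quotient f x y * (y - x)%:C%C + f x) @[y --> F]
    --> lim (diff_quotient f x y @[y --> F]) * 0 + f x.
  apply: cvgD; last exact: cvg_cst.
  exact: cvgM df cvg_increment0.
rewrite mulr0 add0r.
apply: cvg_trans; apply: near_eq_cvg; apply: near_within_dnbhs => y Jy yx /=.
rewrite /diff_quotient divfK ?subrK //.
by rewrite fmorph_eq0 subr_eq0.
Qed.

Definition is_deriv_in f (l : Cplx R) : Prop :=
  diff_quotient f x y @[y --> F] --> l.

Lemma is_deriv_in_deriv f l :
  is_deriv_in f l -> derivable_in J f x /\ deriv_in J f x = l.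
Proof.
move=> fl; have FF := within_dnbhs_proper.
split; first by apply/cvg_ex; exists l.
exact: cvg_lim fl.
Qed.

Lemma is_deriv_in_ext f g l :
  (forall y, J y -> f y = g y) -> is_deriv_in f l -> is_deriv_in g l.
Proof.
move=> fg; have FF := within_dnbhs_proper.
apply: cvg_trans; apply: near_eq_cvg; apply: near_within_dnbhs => y Jy yx.
by rewrite /diff_quotient !fg.
Qed.

Lemma is_deriv_in_cst c : is_deriv_in (fun=> c) 0.
Proof.
have FF := within_dnbhs_proper.
rewrite /is_deriv_in /diff_quotient.
under eq_fun do rewrite subrr mul0r.
exact: cvg_cst.
Qed.

Lemma is_deriv_inD f g a b : is_deriv_in f a -> is_deriv_in g b ->
  is_deriv_in (fun y => f y + g y) (a + b).
Proof.
move=> fa gb; have FF := within_dnbhs_proper.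
have : (diff_quotient f x y + diff_quotient g x y) @[y --> F] --> a + b.
  exact: cvgD fa gb.
apply: cvg_trans; apply: near_eq_cvg; apply: near_within_dnbhs => y Jy yx /=.
rewrite /diff_quotient -mulrDl; congr (_ / _); ring.
Qed.

Lemma is_deriv_inM f g a b : is_deriv_in f a -> is_deriv_in g b ->
  is_deriv_in (fun y => f y * g y) (a * g x + f x * b).
Proof.
move=> fa gb; have FF := within_dnbhs_proper.
have cg := cvgP _ gb.
have : (diff_quotient f x y * g y + f x * diff_quotient g x y) @[y --> F]
    --> a * g x + f x * b.
  apply: cvgD; first exact: cvgM fa (derivable_in_cvg cg).
  apply: cvgM; last exact: gb.
  exact: cvg_cst.
apply: cvg_trans; apply: near_eq_cvg; apply: near_within_dnbhs => y Jy yx /=.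
rewrite /diff_quotient; ring.
Qed.

Lemma is_deriv_inV f a : (forall y, J y -> f y != 0) -> is_deriv_in f a ->
  is_deriv_in (fun y => (f y)^-1) (- a * (f x)^-1 * (f x)^-1).
Proof.
move=> f0 fa; have FF := within_dnbhs_proper.
have cf := derivable_in_cvg (cvgP _ fa).
have : (- diff_quotient f x y * (f y)^-1 * (f x)^-1) @[y --> F]
    --> - a * (f x)^-1 * (f x)^-1.
  apply: cvgM; last exact: cvg_cst.
  apply: cvgM; first exact: cvgN fa.
  exact: cvgV (f0 _ Jx) cf.
apply: cvg_trans; apply: near_eq_cvg; apply: near_within_dnbhs => y Jy yx /=.
have d0 : (y - x)%:C%C != 0 by rewrite fmorph_eq0 subr_eq0.
rewrite /diff_quotient; move: ((y - x)%:C%C) d0 => d d0.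
by field; rewrite d0 !f0.
Qed.

End Derivative.

(** * Taylor polynomials along an interval *)

Lemma poly_primitive (K : numFieldType) (c : K) (Q : {poly K}) :
  exists P : {poly K}, P`_0 = c /\ P^`() = Q.
Proof.
exists (\poly_(i < (size Q).+1) if i is j.+1 then Q`_j / j.+1%:R else c).
split; first by rewrite coef_poly.
apply/polyP => i; rewrite coef_deriv coef_poly ltnS.
case: ltnP => [_|Qi]; last by rewrite mul0rn nth_default.
by rewrite -[LHS]mulr_natr divfK // pnatr_eq0.
Qed.

Section Taylor.
Context (R : realType) (J : set R) (x : R).
Context (hJ : nontrivial_interval J) (Jx : J x).
Implicit Types (f g : R -> Cplx R) (P Q : {poly Cplx R}).

(** [P] agrees up to order [n] with the Taylor expansion of [f] at [x], and
[f] is [n] times differentiable on the whole of [J]. Coefficients of [P]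
beyond [n] are free, so no truncation is needed in products. *)
Fixpoint taylor_at (n : nat) f P : Prop :=
  P`_0 = f x /\
  if n is m.+1 then
    (forall y, J y -> derivable_in J f y) /\ taylor_at m (deriv_in J f) P^`()
  else True.

Lemma taylor_at_ext n f g P : (forall y, J y -> f y = g y) ->
  taylor_at n f P -> taylor_at n g P.
Proof.
elim: n f g P => [|n IH] f g P fg /= [P0 Ht]; rewrite -(fg _ Jx); split => //.
case: Ht => df tf.
have H y : J y -> derivable_in J g y /\ deriv_in J g y = deriv_in J f y.
  move=> Jy; apply: is_deriv_in_deriv => //.
  by apply: is_deriv_in_ext fg _ => //; apply: df.
split; first by move=> y /H [].
by apply: IH tf => y /H [].
Qed.

Lemma taylor_atW n f P : taylor_at n.+1 f P -> taylor_at n f P.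
Proof.
elim: n f P => [|n IH] f P [P0 [df tf]]; first by [].
by split => //; split => //; exact: IH.
Qed.

Lemma taylor_at_cst n c : taylor_at n (fun=> c) c%:P.
Proof.
elim: n c => [|n IH] c; first by rewrite /= coefC.
have H y : J y -> derivable_in J (fun=> c) y /\ deriv_in J (fun=> c) y = 0.
  by move=> Jy; apply: is_deriv_in_deriv => //; exact: is_deriv_in_cst.
split; first by rewrite coefC.
split; first by move=> y /H [].
by rewrite derivC; apply: taylor_at_ext (IH 0) => y /H [_ ->].
Qed.

Lemma taylor_atD n f g P Q : taylor_at n f P -> taylor_at n g Q ->
  taylor_at n (fun y => f y + g y) (P + Q).
Proof.
elim: n f g P Q => [|n IH] f g P Q /= [P0 tf] [Q0 tg].
  by rewrite coefD P0 Q0.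
case: tf tg => df tf [dg tg].
have H y : J y -> derivable_in J (fun y => f y + g y) y /\
    deriv_in J (fun y => f y + g y) y = deriv_in J f y + deriv_in J g y.
  move=> Jy; apply: is_deriv_in_deriv => //.
  by apply: is_deriv_inD => //; [apply: df | apply: dg].
split; first by rewrite coefD P0 Q0.
split; first by move=> y /H [].
by rewrite derivD; apply: taylor_at_ext (IH _ _ _ _ tf tg) => y /H [_ ->].
Qed.

(** By induction on the order: the derivative of the product is
[f' g + f g'], and both summands are products covered by the previous
order. *)
Lemma taylor_atM n f g P Q : taylor_at n f P -> taylor_at n g Q ->
  taylor_at n (fun y => f y * g y) (P * Q).
Proof.
elim: n f g P Q => [|n IH] f g P Q.
  by move=> /= [P0 _] [Q0 _]; rewrite coef0M P0 Q0.
move=> tf tg; have [tf' tg'] := (taylor_atW tf, taylor_atW tg).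
case: tf tg => P0 [df tf] [Q0 [dg tg]].
have H y : J y -> derivable_in J (fun y => f y * g y) y /\
    deriv_in J (fun y => f y * g y) y
    = deriv_in J f y * g y + f y * deriv_in J g y.
  move=> Jy; apply: is_deriv_in_deriv => //.
  by apply: is_deriv_inM => //; [apply: df | apply: dg].
split; first by rewrite coef0M P0 Q0.
split; first by move=> y /H [].
rewrite derivM.
have := taylor_atD (IH _ _ _ _ tf tg') (IH _ _ _ _ tf' tg).
by apply: taylor_at_ext => y /H [_ ->].
Qed.

Lemma taylor_atX n f P k : taylor_at n f P ->
  taylor_at n (fun y => f y ^+ k) (P ^+ k).
Proof.
move=> tf; elim: k => [|k IH]; first exact: taylor_at_cst.
rewrite exprS; apply: taylor_at_ext (taylor_atM tf IH) => y _.
by rewrite exprS.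
Qed.

Lemma taylor_at_primitive n f Q : (forall y, J y -> derivable_in J f y) ->
  taylor_at n (deriv_in J f) Q -> exists P, taylor_at n.+1 f P.
Proof.
move=> df tQ; have [P [P0 PQ]] := poly_primitive (f x) Q.
by exists P; rewrite /= PQ.
Qed.

(** The polynomial is built by induction on the order: [(1/f)'] is
[- f' (1/f) (1/f)], whose expansion to order [n] is known from those of [f']
and [1/f], and a primitive of it expands [1/f] to order [n + 1]. *)
Lemma taylor_atV n f P : (forall y, J y -> f y != 0) -> taylor_at n f P ->
  exists Q, taylor_at n (fun y => (f y)^-1) Q.
Proof.
move=> f0; elim: n P => [|n IH] P.
  by exists ((f x)^-1)%:P; rewrite /= coefC.
move=> tf; have [Q tQ] := IH _ (taylor_atW tf).
case: tf => P0 [df tf].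
have H y : J y -> derivable_in J (fun y => (f y)^-1) y /\
    deriv_in J (fun y => (f y)^-1) y
    = - 1 * deriv_in J f y * (f y)^-1 * (f y)^-1.
  move=> Jy; apply: is_deriv_in_deriv => //; rewrite mulN1r.
  by apply: is_deriv_inV => //; apply: df.
apply: (@taylor_at_primitive _ _ ((-1)%:P * P^`() * Q * Q)).
  by move=> y /H [].
have := taylor_atM (taylor_atM (taylor_atM (taylor_at_cst n (-1)) tf) tQ) tQ.
by apply: taylor_at_ext => y /H [_ ->].
Qed.

Lemma class_C_taylor_at n f : class_C n J f -> exists P, taylor_at n f P.
Proof.
case=> + _; elim: n f => [|n IH] f df.
  by exists (f x)%:P; rewrite /= coefC.
have [|Q tQ] := IH (deriv_in J f).
  by move=> k kn y Jy; rewrite /derivn_in -iterSr; exact: (df k.+1).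
by apply: taylor_at_primitive tQ; exact: (df 0%N).
Qed.

Lemma derivn_taylor_at n f P k : taylor_at n f P -> (k <= n)%N ->
  derivn_in J k f x = k`!%:R * P`_k.
Proof.
elim: n f P k => [|n IH] f P [|k] //=; rewrite ?mul1r; try by case.
move=> [_ [_ tf]] kn; rewrite -[LHS]/(iter k.+1 _ f x) iterSr.
rewrite [LHS](IH _ _ _ tf kn) coef_deriv factS natrM -mulr_natr; ring.
Qed.

End Taylor.

(** * The identity *)

Lemma bin_scaled_coef (K : numFieldType) (n p : nat) (c a b : K) : (p <= n)%N ->
  'C(n, p)%:R * (1 / c) * (p`!%:R * a) * ((n - p)`!%:R * b)
  = n`!%:R * (c^-1 * a * b).
Proof. by move=> pn; rewrite -(bin_fact pn) !natrM; ring. Qed.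

Unset Implicit Arguments.

Theorem proposition2p1 (R : realType) (n : nat) (J : set R)
  (hJ : nontrivial_interval J) (lam : nat) (hlam : (1 <= lam)%N)
  (u v w : R -> Cplx R)
  (hu : class_C n J u) (hv : class_C n J v) (hw : class_C n J w)
  (u_neq0 : forall x : R, J x -> u x != 0) :
  forall x : R, J x ->
    \sum_(p < n.+1) ('C(n, p))%:R * (1 / (p + lam)%:R)
      * derivn_in J p (fun y => u y ^+ (p + lam) * w y) x
      * derivn_in J (n - p) (fun y => u y ^- (p + lam) * v y) x
    = \sum_(p < n.+1) ('C(n, p))%:R * (1 / (p + lam)%:R)
      * derivn_in J p w x * derivn_in J (n - p) v x.
Proof.
move=> x Jx.
have [U tU] := class_C_taylor_at x hu.
have [W tW] := class_C_taylor_at x hw.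
have [V tV] := class_C_taylor_at x hv.
have [Y tY] := taylor_atV hJ Jx u_neq0 tU.
have tZ := taylor_atM hJ Jx (taylor_atX hJ Jx (n + lam) tY) tV.
set Z := Y ^+ _ * V in tZ.
have tUZ k := taylor_atM hJ Jx (taylor_atX hJ Jx k tU) tZ.
have {}tV : taylor_at J x n v (U ^+ (n + lam) * Z).
  apply: taylor_at_ext (tUZ _) => // y Jy.
  by rewrite mulrA -exprMn divff ?expr1n ?mul1r // u_neq0.
have tuv (p : 'I_n.+1) :
    taylor_at J x n (fun y => u y ^- (p + lam) * v y) (U ^+ (n - p) * Z).
  have pn : (p <= n)%N by rewrite -ltnS.
  apply: taylor_at_ext (tUZ _) => // y Jy; rewrite mulrA; congr (_ * _).
  have uy : u y != 0 by exact: u_neq0.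
  have -> : (n + lam = (n - p) + (p + lam))%N by rewrite addnA subnK.
  rewrite exprD mulrA -exprMn divff //.
  by rewrite expr1n mul1r exprVn.
transitivity (n`!%:R * \sum_(p < n.+1) ((p + lam)%:R)^-1
    * (U ^+ (p + lam) * W)`_p * (U ^+ (n - p) * Z)`_(n - p)).
  rewrite mulr_sumr; apply: eq_bigr => p _.
  have pn : (p <= n)%N by rewrite -ltnS.
  have tuw := taylor_atM hJ Jx (taylor_atX hJ Jx (p + lam) tU) tW.
  rewrite (derivn_taylor_at tuw pn) (derivn_taylor_at (tuv p) (leq_subr p n)).
  exact: bin_scaled_coef.
rewrite rothe_bilinear // mulr_sumr; apply: eq_bigr => p _.
have pn : (p <= n)%N by rewrite -ltnS.
rewrite (derivn_taylor_at tW pn) (derivn_taylor_at tV (leq_subr p n)).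
by rewrite bin_scaled_coef.
Qed.
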